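(* The calculus D.LRC enjoys cut elimination and the subformula property: every sequent derivable in D.LRC has a derivation in D.LRC that uses neither of the two cut rules; and every sequent derivable in D.LRC has a derivation in which every formula and every resource term occurring is a subterm of some formula or resource term occurring in the conclusion.
   Context: LANGUAGE. Fix countable disjoint sets $\mathsf{AtProp}$ and $\mathsf{AtRes}$. Resource terms: $\alpha::=a\in\mathsf{AtRes}\mid 1\mid 0\mid\alpha\cdot\alpha\mid\alpha\sqcup\alpha\mid\alpha\sqcap\alpha$. Formulas: $A::=p\in\mathsf{AtProp}\mid\top\mid\bot\mid A\vee A\mid A\wedge A\mid A\to A\mid\alpha\vartriangleright A\mid\Diamond A\mid\Diamond_r\alpha\mid\alpha\vartriangleright_r\alpha$. STRUCTURES OF D.LRC. Structures are of type Fm ($X,Y,Z,W$) or Res ($\Gamma,\Delta,\Sigma,\Pi$), and occur in antecedent ($a$) or succedent ($s$) position. With $A$ ranging over formulas and $\alpha$ over resource terms: $X_a::=A\mid\mathrm{I}\mid X_a;X_a\mid X_s>X_a\mid X_a<X_s\mid\circ X_a\mid\circ_r\Gamma_a$; $X_s::=A\mid\mathrm{I}\mid X_s;X_s\mid X_a>X_s\mid X_s<X_a\mid\bullet X_s\mid\Gamma_a\,\hat{\vartriangleright}\,X_s\mid\Gamma_a\,\hat{\vartriangleright}_r\,\Gamma_s$; $\Gamma_a::=\alpha\mid\Phi\mid\Gamma_a\odot\Gamma_a\mid\Gamma_a,\Gamma_a\mid\Gamma_s\sqsupset\Gamma_a\mid\Gamma_a\sqsubset\Gamma_s\mid\Gamma_a\,\hat{\blacktriangle}_r\,X_a$;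 $\Gamma_s::=\alpha\mid\Phi\mid\Gamma_s,\Gamma_s\mid\Gamma_a\gtrdot\Gamma_s\mid\Gamma_s\lessdot\Gamma_a\mid\Gamma_a\sqsupset\Gamma_s\mid\Gamma_s\sqsubset\Gamma_a\mid\bullet_rX_s\mid X_a\,\hat{\blacktriangleright}\,X_s\mid X_a\,\hat{\blacktriangleright}_r\,\Gamma_s$. Sequents: $X_a\vdash X_s$ or $\Gamma_a\vdash\Gamma_s$ (subscripts omitted below; each rule instance must consist of such well-positioned sequents). RULES OF D.LRC (''$S/T$'': from $S$ infer $T$; ''$S\,//\,T$'': both directions). Axioms: $p\vdash p$; $a\vdash a$ (atoms). Cut: $(X\vdash Y)[A]^{succ}$, $A\vdash Z\,/\,(X\vdash Y)[Z/A]^{succ}$ (replacing an occurrence of $A$ as a substructure in succedent position); $\Gamma\vdash\alpha$, $\alpha\vdash\Delta\,/\,\Gamma\vdash\Delta$. Display Fm: $X;Y\vdash Z//Y\vdash X>Z$; $Z\vdash X;Y//X>Z\vdash Y$; $X;Y\vdash Z//X\vdash Z<Y$; $Z\vdash X;Y//Z<Y\vdash X$. Display Res: $\Gamma,\Delta\vdash\Sigma//\Delta\vdash\Gamma\sqsupset\Sigma$; $\Gamma,\Delta\vdash\Sigma//\Gamma\vdash\Sigma\sqsubset\Delta$; $\Gamma\vdash\Delta,\Sigma//\Delta\sqsupset\Gamma\vdash\Sigma$; $\Gamma\vdash\Delta,\Sigma//\Gamma\sqsubset\Sigma\vdash\Delta$; $\Gamma\odot\Delta\vdash\Sigma//\Delta\vdash\Gamma\gtrdot\Sigma$;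 $\Gamma\odot\Delta\vdash\Sigma//\Gamma\vdash\Sigma\lessdot\Delta$. Display modal: $\circ X\vdash Y//X\vdash\bullet Y$; $\circ_r\Gamma\vdash X//\Gamma\vdash\bullet_rX$; $X\vdash\Gamma\hat{\vartriangleright}Y//\Gamma\vdash X\hat{\blacktriangleright}Y$; $X\vdash\Gamma\hat{\vartriangleright}_r\Delta//\Gamma\hat{\blacktriangle}_rX\vdash\Delta$; $X\vdash\Gamma\hat{\vartriangleright}_r\Delta//\Gamma\vdash X\hat{\blacktriangleright}_r\Delta$. Structural Fm: $X\vdash Y//\mathrm{I};X\vdash Y$; $Y\vdash X//Y\vdash X;\mathrm{I}$; $Y;X\vdash Z/X;Y\vdash Z$; $Z\vdash X;Y/Z\vdash Y;X$; $Y\vdash Z/X;Y\vdash Z$; $Z\vdash Y/Z\vdash Y;X$; $X;X\vdash Y/X\vdash Y$; $Y\vdash X;X/Y\vdash X$; $X;(Y;Z)\vdash W//(X;Y);Z\vdash W$; $W\vdash(Z;Y);X//W\vdash Z;(Y;X)$. Structural Res: $\Gamma\odot\Phi\vdash\Delta//\Gamma\vdash\Delta$; $\Gamma\vdash\Delta//\Phi\odot\Gamma\vdash\Delta$; $\Gamma\vdash\Delta//\Gamma\vdash\Delta,\Phi$; $\Gamma\odot(\Delta\odot\Sigma)\vdash\Pi//(\Gamma\odot\Delta)\odot\Sigma\vdash\Pi$; $\Phi\vdash\Delta/\Gamma\vdash\Delta$; $\Gamma\vdash\Delta/\Gamma,\Sigma\vdash\Delta$; $\Gamma\vdash\Delta/\Gamma\vdash\Delta,\Sigma$;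 $\Gamma,\Gamma\vdash\Delta/\Gamma\vdash\Delta$; $\Gamma\vdash\Delta,\Delta/\Gamma\vdash\Delta$; $\Gamma,\Delta\vdash\Sigma/\Delta,\Gamma\vdash\Sigma$; $\Sigma\vdash\Gamma,\Delta/\Sigma\vdash\Delta,\Gamma$; $\Sigma,(\Delta,\Gamma)\vdash\Pi//(\Sigma,\Delta),\Gamma\vdash\Pi$; $\Pi\vdash\Sigma,(\Delta,\Gamma)//\Pi\vdash(\Sigma,\Delta),\Gamma$; $\Pi\vdash(\Gamma\gtrdot\Delta),(\Gamma\gtrdot\Sigma)/\Pi\vdash\Gamma\gtrdot(\Delta,\Sigma)$. D-rules: $X\vdash\bullet Y;\bullet Z/X\vdash\bullet(Y;Z)$; $\Gamma\vdash\bullet_rX,\bullet_rY/\Gamma\vdash\bullet_r(X;Y)$; $X\vdash\mathrm{I}/X\vdash\bullet\mathrm{I}$; $\Gamma\vdash\Phi/\Gamma\vdash\bullet_r\mathrm{I}$. B-rules: $\Gamma\vdash(Y\hat{\blacktriangleright}_r\Delta),(Z\hat{\blacktriangleright}_r\Delta)/\Gamma\vdash(Y;Z)\hat{\blacktriangleright}_r\Delta$; $\Gamma\vdash(Y\hat{\blacktriangleright}W),(Z\hat{\blacktriangleright}W)/\Gamma\vdash(Y;Z)\hat{\blacktriangleright}W$; $(\Gamma\hat{\blacktriangle}_rX),(\Gamma\hat{\blacktriangle}_rY)\vdash\Delta/\Gamma\hat{\blacktriangle}_r(X;Y)\vdash\Delta$; $X\vdash\Gamma\hat{\vartriangleright}(\Delta\hat{\vartriangleright}Y)/X\vdash(\Gamma\odot\Delta)\hat{\vartriangleright}Y$;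 $\Phi\vdash\Delta/\Gamma\hat{\blacktriangle}_r\mathrm{I}\vdash\Delta$. BD-rules: $X\vdash\Gamma\hat{\vartriangleright}\bullet Y/X\vdash\circ_r\Gamma>Y$; $X\vdash\Gamma\hat{\vartriangleright}_r\bullet_rY/X\vdash\Gamma\hat{\vartriangleright}Y$. Logical Fm: $\bot\vdash\mathrm{I}$; $X\vdash\mathrm{I}/X\vdash\bot$; $\mathrm{I}\vdash X/\top\vdash X$; $\mathrm{I}\vdash\top$; $A;B\vdash X/A\wedge B\vdash X$; $X\vdash A,\ Y\vdash B$ (two premises) $/X;Y\vdash A\wedge B$; $A\vdash X$ and $B\vdash Y/A\vee B\vdash X;Y$; $X\vdash A;B/X\vdash A\vee B$; $X\vdash A$ and $B\vdash Y/A\to B\vdash X>Y$; $X\vdash A>B/X\vdash A\to B$. Logical Res: $0\vdash\Phi$; $\Gamma\vdash\Phi/\Gamma\vdash0$; $\Phi\vdash\Gamma/1\vdash\Gamma$; $\Phi\vdash1$; $\alpha\odot\beta\vdash\Gamma/\alpha\cdot\beta\vdash\Gamma$; $\Gamma\vdash\alpha$ and $\Delta\vdash\beta/\Gamma\odot\Delta\vdash\alpha\cdot\beta$; $\alpha\vdash\Gamma$ and $\beta\vdash\Delta/\alpha\sqcup\beta\vdash(\Gamma,\Delta)$; $\Gamma\vdash(\alpha,\beta)/\Gamma\vdash\alpha\sqcup\beta$; $(\alpha,\beta)\vdash\Gamma/\alpha\sqcap\beta\vdash\Gamma$; $\Gamma\vdash\alpha$ and $\Delta\vdash\beta/(\Gamma,\Delta)\vdash\alpha\sqcap\beta$.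 Logical modal: $\circ A\vdash X/\Diamond A\vdash X$; $X\vdash A/\circ X\vdash\Diamond A$; $\Gamma\vdash\alpha$ and $A\vdash X/\alpha\vartriangleright A\vdash\Gamma\hat{\vartriangleright}X$; $X\vdash\alpha\hat{\vartriangleright}A/X\vdash\alpha\vartriangleright A$; $\circ_r\alpha\vdash X/\Diamond_r\alpha\vdash X$; $\Gamma\vdash\alpha/\circ_r\Gamma\vdash\Diamond_r\alpha$; $\Gamma\vdash\alpha$ and $\beta\vdash\Delta/\alpha\vartriangleright_r\beta\vdash\Gamma\hat{\vartriangleright}_r\Delta$; $X\vdash\alpha\hat{\vartriangleright}_r\beta/X\vdash\alpha\vartriangleright_r\beta$. *)

(* Defs.v *)
From mathcomp Require Import all_boot.

Set Implicit Arguments.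
Unset Strict Implicit.
Unset Printing Implicit Defensive.

(* The two sets of atoms range over arbitrary countable types; they are
   disjoint because they are tagged by different constructors in two
   different syntactic sorts. *)

Inductive res (AtRes : countType) : Type :=
| ratom of AtRes
| rone
| rzero
| rdot of res AtRes & res AtRes
| rjoin of res AtRes & res AtRes
| rmeet of res AtRes & res AtRes.

Inductive form (AtProp AtRes : countType) : Type :=
| patom of AtProp
| ftop
| fbot
| for_ of form AtProp AtRes & form AtProp AtRes
| fand of form AtProp AtRes & form AtProp AtRes
| fimp of form AtProp AtRes & form AtProp AtRes
| ftri of res AtRes & form AtProp AtRes
| fdia of form AtProp AtRes
| fdiar of res AtRes
| ftrir of res AtRes & res AtRes.

Arguments rone {AtRes}.
Arguments rzero {AtRes}.
Arguments patom {AtProp AtRes}.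
Arguments ftop {AtProp AtRes}.
Arguments fbot {AtProp AtRes}.
Arguments fdiar {AtProp AtRes}.
Arguments ftrir {AtProp AtRes}.

(* fa, fs: structures of type Fm in antecedent, succedent position;
   ra, rs: structures of type Res in antecedent, succedent position.
   Polarity is part of the type, so that only well-positioned sequents and
   rule instances can be written. *)
Inductive fa (AtProp AtRes : countType) : Type :=
| fa_form of form AtProp AtRes
| fa_I
| fa_semi of fa AtProp AtRes & fa AtProp AtRes
| fa_gt of fs AtProp AtRes & fa AtProp AtRes
| fa_lt of fa AtProp AtRes & fs AtProp AtRes
| fa_circ of fa AtProp AtRes
| fa_circr of ra AtProp AtRes
with fs (AtProp AtRes : countType) : Type :=
| fs_form of form AtProp AtRes
| fs_I
| fs_semi of fs AtProp AtRes & fs AtProp AtRes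
| fs_gt of fa AtProp AtRes & fs AtProp AtRes
| fs_lt of fs AtProp AtRes & fa AtProp AtRes
| fs_bull of fs AtProp AtRes
| fs_tri of ra AtProp AtRes & fs AtProp AtRes
| fs_trir of ra AtProp AtRes & rs AtProp AtRes
with ra (AtProp AtRes : countType) : Type :=
| ra_res of res AtRes
| ra_Phi
| ra_odot of ra AtProp AtRes & ra AtProp AtRes
| ra_comma of ra AtProp AtRes & ra AtProp AtRes
| ra_sup of rs AtProp AtRes & ra AtProp AtRes
| ra_sub of ra AtProp AtRes & rs AtProp AtRes
| ra_btriur of ra AtProp AtRes & fa AtProp AtRes
with rs (AtProp AtRes : countType) : Type :=
| rs_res of res AtRes
| rs_Phi
| rs_comma of rs AtProp AtRes & rs AtProp AtRes
| rs_gtrdot of ra AtProp AtRes & rs AtProp AtRes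
| rs_lessdot of rs AtProp AtRes & ra AtProp AtRes
| rs_sup of ra AtProp AtRes & rs AtProp AtRes
| rs_sub of rs AtProp AtRes & ra AtProp AtRes
| rs_bullr of fs AtProp AtRes
| rs_btri of fa AtProp AtRes & fs AtProp AtRes
| rs_btrir of fa AtProp AtRes & rs AtProp AtRes.

Arguments fa_I {AtProp AtRes}.
Arguments fs_I {AtProp AtRes}.
Arguments ra_res {AtProp AtRes}.
Arguments ra_Phi {AtProp AtRes}.
Arguments rs_res {AtProp AtRes}.
Arguments rs_Phi {AtProp AtRes}.

Inductive sequent (AtProp AtRes : countType) : Type :=
| fm_seq of fa AtProp AtRes & fs AtProp AtRes
| res_seq of ra AtProp AtRes & rs AtProp AtRes.

Coercion fa_form : form >-> fa.
Coercion fs_form : form >-> fs.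
#[warning="-uniform-inheritance"] Coercion ra_res : res >-> ra.
#[warning="-uniform-inheritance"] Coercion rs_res : res >-> rs.

Declare Scope lang_scope.
Declare Scope fa_scope.
Declare Scope fs_scope.
Declare Scope ra_scope.
Declare Scope rs_scope.
Delimit Scope lang_scope with lang.
Delimit Scope fa_scope with fa.
Delimit Scope fs_scope with fs.
Delimit Scope ra_scope with ra.
Delimit Scope rs_scope with rs.

Reserved Notation "a · b" (at level 60, no associativity).
Reserved Notation "a ⊔ b" (at level 60, no associativity).
Reserved Notation "a ⊓ b" (at level 60, no associativity).
Reserved Notation "A ∨ B" (at level 60, no associativity).
Reserved Notation "A ∧ B" (at level 60, no associativity).
Reserved Notation "A ⇒ B" (at level 60, no associativity).
Reserved Notation "a ▷ A" (at level 60, no associativity).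
Reserved Notation "a ▷r b" (at level 60, no associativity).
Reserved Notation "◇ A" (at level 55, right associativity).
Reserved Notation "◇r a" (at level 55, right associativity).
Reserved Notation "X ;; Y" (at level 70, no associativity).
Reserved Notation "∘ X" (at level 65, right associativity).
Reserved Notation "∘r G" (at level 65, right associativity).
Reserved Notation "• X" (at level 65, right associativity).
Reserved Notation "•r X" (at level 65, right associativity).
Reserved Notation "G ^▷ X" (at level 70, no associativity).
Reserved Notation "G ^▷r D" (at level 70, no associativity).
Reserved Notation "G ⊙ D" (at level 70, no associativity).
Reserved Notation "G ,, D" (at level 70, no associativity).
Reserved Notation "G ⊐ D" (at level 70, no associativity).
Reserved Notation "G ⊏ D" (at level 70, no associativity).
Reserved Notation "G ⋗ D" (at level 70, no associativity).
Reserved Notation "G ⋖ D" (at level 70, no associativity).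
Reserved Notation "G ^▲r X" (at level 70, no associativity).
Reserved Notation "X ^▶ Y" (at level 70, no associativity).
Reserved Notation "X ^▶r D" (at level 70, no associativity).
Reserved Notation "X ⊢ Y" (at level 80, no associativity).
Reserved Notation "G ⊩ D" (at level 80, no associativity).

Notation "a · b" := (rdot a b) : lang_scope.
Notation "a ⊔ b" := (rjoin a b) : lang_scope.
Notation "a ⊓ b" := (rmeet a b) : lang_scope.
Notation "A ∨ B" := (for_ A B) : lang_scope.
Notation "A ∧ B" := (fand A B) : lang_scope.
Notation "A ⇒ B" := (fimp A B) : lang_scope.
Notation "a ▷ A" := (ftri a A) : lang_scope.
Notation "a ▷r b" := (ftrir a b) : lang_scope.
Notation "◇ A" := (fdia A) : lang_scope.
Notation "◇r a" := (fdiar a) : lang_scope.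

Notation "\I" := fa_I : fa_scope.
Notation "X ;; Y" := (fa_semi X%fa Y%fa) : fa_scope.
Notation "X > Y" := (fa_gt X%fs Y%fa) : fa_scope.
Notation "X < Y" := (fa_lt X%fa Y%fs) : fa_scope.
Notation "∘ X" := (fa_circ X%fa) : fa_scope.
Notation "∘r G" := (fa_circr G%ra) : fa_scope.

Notation "\I" := fs_I : fs_scope.
Notation "X ;; Y" := (fs_semi X%fs Y%fs) : fs_scope.
Notation "X > Y" := (fs_gt X%fa Y%fs) : fs_scope.
Notation "X < Y" := (fs_lt X%fs Y%fa) : fs_scope.
Notation "• X" := (fs_bull X%fs) : fs_scope.
Notation "G ^▷ X" := (fs_tri G%ra X%fs) : fs_scope.
Notation "G ^▷r D" := (fs_trir G%ra D%rs) : fs_scope.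

Notation "\Phi" := ra_Phi : ra_scope.
Notation "G ⊙ D" := (ra_odot G%ra D%ra) : ra_scope.
Notation "G ,, D" := (ra_comma G%ra D%ra) : ra_scope.
Notation "G ⊐ D" := (ra_sup G%rs D%ra) : ra_scope.
Notation "G ⊏ D" := (ra_sub G%ra D%rs) : ra_scope.
Notation "G ^▲r X" := (ra_btriur G%ra X%fa) : ra_scope.

Notation "\Phi" := rs_Phi : rs_scope.
Notation "G ,, D" := (rs_comma G%rs D%rs) : rs_scope.
Notation "G ⋗ D" := (rs_gtrdot G%ra D%rs) : rs_scope.
Notation "G ⋖ D" := (rs_lessdot G%rs D%ra) : rs_scope.
Notation "G ⊐ D" := (rs_sup G%ra D%rs) : rs_scope.
Notation "G ⊏ D" := (rs_sub G%rs D%ra) : rs_scope.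
Notation "•r X" := (rs_bullr X%fs) : rs_scope.
Notation "X ^▶ Y" := (rs_btri X%fa Y%fs) : rs_scope.
Notation "X ^▶r D" := (rs_btrir X%fa D%rs) : rs_scope.

(* X ⊢ Y is a sequent of type Fm, G ⊩ D a sequent of type Res. *)
Notation "X ⊢ Y" := (fm_seq X%fa Y%fs) : lang_scope.
Notation "G ⊩ D" := (res_seq G%ra D%rs) : lang_scope.

Open Scope lang_scope.

Section Calculus.

Variables AtProp AtRes : countType.

Local Notation form := (form AtProp AtRes).
Local Notation res := (res AtRes).
Local Notation fa := (fa AtProp AtRes).
Local Notation fs := (fs AtProp AtRes).
Local Notation ra := (ra AtProp AtRes).
Local Notation rs := (rs AtProp AtRes).
Local Notation sequent := (sequent AtProp AtRes).

Implicit Types (p : AtProp) (a : AtRes) (A B : form) (α β : res).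

(* subst_* A Z T T': T' results from T by replacing exactly one occurrence
   of the formula A as a substructure in succedent position by Z. *)
Inductive subst_fa A (Z : fs) : fa -> fa -> Prop :=
| subst_fa_semi_l X X' Y :
    subst_fa A Z X X' -> subst_fa A Z (X ;; Y)%fa (X' ;; Y)%fa
| subst_fa_semi_r X Y Y' :
    subst_fa A Z Y Y' -> subst_fa A Z (X ;; Y)%fa (X ;; Y')%fa
| subst_fa_gt_l X X' Y :
    subst_fs A Z X X' -> subst_fa A Z (X > Y)%fa (X' > Y)%fa
| subst_fa_gt_r X Y Y' :
    subst_fa A Z Y Y' -> subst_fa A Z (X > Y)%fa (X > Y')%fa
| subst_fa_lt_l X X' Y :
    subst_fa A Z X X' -> subst_fa A Z (X < Y)%fa (X' < Y)%fa
| subst_fa_lt_r X Y Y' :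
    subst_fs A Z Y Y' -> subst_fa A Z (X < Y)%fa (X < Y')%fa
| subst_fa_circ X X' :
    subst_fa A Z X X' -> subst_fa A Z (∘ X)%fa (∘ X')%fa
| subst_fa_circr G G' :
    subst_ra A Z G G' -> subst_fa A Z (∘r G)%fa (∘r G')%fa
with subst_fs A (Z : fs) : fs -> fs -> Prop :=
| subst_fs_here : subst_fs A Z A Z
| subst_fs_semi_l X X' Y :
    subst_fs A Z X X' -> subst_fs A Z (X ;; Y)%fs (X' ;; Y)%fs
| subst_fs_semi_r X Y Y' :
    subst_fs A Z Y Y' -> subst_fs A Z (X ;; Y)%fs (X ;; Y')%fs
| subst_fs_gt_l X X' Y :
    subst_fa A Z X X' -> subst_fs A Z (X > Y)%fs (X' > Y)%fs
| subst_fs_gt_r X Y Y' :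
    subst_fs A Z Y Y' -> subst_fs A Z (X > Y)%fs (X > Y')%fs
| subst_fs_lt_l X X' Y :
    subst_fs A Z X X' -> subst_fs A Z (X < Y)%fs (X' < Y)%fs
| subst_fs_lt_r X Y Y' :
    subst_fa A Z Y Y' -> subst_fs A Z (X < Y)%fs (X < Y')%fs
| subst_fs_bull X X' :
    subst_fs A Z X X' -> subst_fs A Z (• X)%fs (• X')%fs
| subst_fs_tri_l G G' X :
    subst_ra A Z G G' -> subst_fs A Z (G ^▷ X)%fs (G' ^▷ X)%fs
| subst_fs_tri_r G X X' :
    subst_fs A Z X X' -> subst_fs A Z (G ^▷ X)%fs (G ^▷ X')%fs
| subst_fs_trir_l G G' D :
    subst_ra A Z G G' -> subst_fs A Z (G ^▷r D)%fs (G' ^▷r D)%fs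
| subst_fs_trir_r G D D' :
    subst_rs A Z D D' -> subst_fs A Z (G ^▷r D)%fs (G ^▷r D')%fs
with subst_ra A (Z : fs) : ra -> ra -> Prop :=
| subst_ra_odot_l G G' D :
    subst_ra A Z G G' -> subst_ra A Z (G ⊙ D)%ra (G' ⊙ D)%ra
| subst_ra_odot_r G D D' :
    subst_ra A Z D D' -> subst_ra A Z (G ⊙ D)%ra (G ⊙ D')%ra
| subst_ra_comma_l G G' D :
    subst_ra A Z G G' -> subst_ra A Z (G ,, D)%ra (G' ,, D)%ra
| subst_ra_comma_r G D D' :
    subst_ra A Z D D' -> subst_ra A Z (G ,, D)%ra (G ,, D')%ra
| subst_ra_sup_l G G' D :
    subst_rs A Z G G' -> subst_ra A Z (G ⊐ D)%ra (G' ⊐ D)%ra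
| subst_ra_sup_r G D D' :
    subst_ra A Z D D' -> subst_ra A Z (G ⊐ D)%ra (G ⊐ D')%ra
| subst_ra_sub_l G G' D :
    subst_ra A Z G G' -> subst_ra A Z (G ⊏ D)%ra (G' ⊏ D)%ra
| subst_ra_sub_r G D D' :
    subst_rs A Z D D' -> subst_ra A Z (G ⊏ D)%ra (G ⊏ D')%ra
| subst_ra_btriur_l G G' X :
    subst_ra A Z G G' -> subst_ra A Z (G ^▲r X)%ra (G' ^▲r X)%ra
| subst_ra_btriur_r G X X' :
    subst_fa A Z X X' -> subst_ra A Z (G ^▲r X)%ra (G ^▲r X')%ra
with subst_rs A (Z : fs) : rs -> rs -> Prop :=
| subst_rs_comma_l G G' D :
    subst_rs A Z G G' -> subst_rs A Z (G ,, D)%rs (G' ,, D)%rs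
| subst_rs_comma_r G D D' :
    subst_rs A Z D D' -> subst_rs A Z (G ,, D)%rs (G ,, D')%rs
| subst_rs_gtrdot_l G G' D :
    subst_ra A Z G G' -> subst_rs A Z (G ⋗ D)%rs (G' ⋗ D)%rs
| subst_rs_gtrdot_r G D D' :
    subst_rs A Z D D' -> subst_rs A Z (G ⋗ D)%rs (G ⋗ D')%rs
| subst_rs_lessdot_l G G' D :
    subst_rs A Z G G' -> subst_rs A Z (G ⋖ D)%rs (G' ⋖ D)%rs
| subst_rs_lessdot_r G D D' :
    subst_ra A Z D D' -> subst_rs A Z (G ⋖ D)%rs (G ⋖ D')%rs
| subst_rs_sup_l G G' D :
    subst_ra A Z G G' -> subst_rs A Z (G ⊐ D)%rs (G' ⊐ D)%rs
| subst_rs_sup_r G D D' :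
    subst_rs A Z D D' -> subst_rs A Z (G ⊐ D)%rs (G ⊐ D')%rs
| subst_rs_sub_l G G' D :
    subst_rs A Z G G' -> subst_rs A Z (G ⊏ D)%rs (G' ⊏ D)%rs
| subst_rs_sub_r G D D' :
    subst_ra A Z D D' -> subst_rs A Z (G ⊏ D)%rs (G ⊏ D')%rs
| subst_rs_bullr X X' :
    subst_fs A Z X X' -> subst_rs A Z (•r X)%rs (•r X')%rs
| subst_rs_btri_l X X' Y :
    subst_fa A Z X X' -> subst_rs A Z (X ^▶ Y)%rs (X' ^▶ Y)%rs
| subst_rs_btri_r X Y Y' :
    subst_fs A Z Y Y' -> subst_rs A Z (X ^▶ Y)%rs (X ^▶ Y')%rs
| subst_rs_btrir_l X X' D :
    subst_fa A Z X X' -> subst_rs A Z (X ^▶r D)%rs (X' ^▶r D)%rs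
| subst_rs_btrir_r X D D' :
    subst_rs A Z D D' -> subst_rs A Z (X ^▶r D)%rs (X ^▶r D')%rs.

Inductive axiom : sequent -> Prop :=
| ax_prop p : axiom (patom p ⊢ patom p)
| ax_res a : axiom (ratom a ⊩ ratom a)
| ax_bot : axiom (fbot ⊢ \I)
| ax_top : axiom (\I ⊢ ftop)
| ax_zero : axiom (rzero ⊩ \Phi)
| ax_one : axiom (\Phi ⊩ rone).

(* The double-line rules: each may be applied in both directions. *)
Inductive display : sequent -> sequent -> Prop :=
| disp_semi_gt X Y Z : display (X ;; Y ⊢ Z) (Y ⊢ X > Z)
| disp_gt_semi X Y Z : display (Z ⊢ X ;; Y) (X > Z ⊢ Y)
| disp_semi_lt X Y Z : display (X ;; Y ⊢ Z) (X ⊢ Z < Y)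
| disp_lt_semi X Y Z : display (Z ⊢ X ;; Y) (Z < Y ⊢ X)
| disp_comma_sup G D S : display (G ,, D ⊩ S) (D ⊩ G ⊐ S)
| disp_comma_sub G D S : display (G ,, D ⊩ S) (G ⊩ S ⊏ D)
| disp_sup_comma G D S : display (G ⊩ D ,, S) (D ⊐ G ⊩ S)
| disp_sub_comma G D S : display (G ⊩ D ,, S) (G ⊏ S ⊩ D)
| disp_odot_gtrdot G D S : display (G ⊙ D ⊩ S) (D ⊩ G ⋗ S)
| disp_odot_lessdot G D S : display (G ⊙ D ⊩ S) (G ⊩ S ⋖ D)
| disp_circ X Y : display (∘ X ⊢ Y) (X ⊢ • Y)
| disp_circr G X : display (∘r G ⊢ X) (G ⊩ •r X)
| disp_tri G X Y : display (X ⊢ G ^▷ Y) (G ⊩ X ^▶ Y)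
| disp_trir_up G D X : display (X ⊢ G ^▷r D) (G ^▲r X ⊩ D)
| disp_trir G D X : display (X ⊢ G ^▷r D) (G ⊩ X ^▶r D).

Inductive structural_bi : sequent -> sequent -> Prop :=
| sb_I_l X Y : structural_bi (X ⊢ Y) (\I ;; X ⊢ Y)
| sb_I_r X Y : structural_bi (Y ⊢ X) (Y ⊢ X ;; \I)
| sb_semi_assoc_l X Y Z W :
    structural_bi (X ;; (Y ;; Z) ⊢ W) ((X ;; Y) ;; Z ⊢ W)
| sb_semi_assoc_r X Y Z W :
    structural_bi (W ⊢ (Z ;; Y) ;; X) (W ⊢ Z ;; (Y ;; X))
| sb_Phi_odot_r G D : structural_bi (G ⊙ \Phi ⊩ D) (G ⊩ D)
| sb_Phi_odot_l G D : structural_bi (G ⊩ D) (\Phi ⊙ G ⊩ D)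
| sb_Phi_comma G D : structural_bi (G ⊩ D) (G ⊩ D ,, \Phi)
| sb_odot_assoc G D S P :
    structural_bi (G ⊙ (D ⊙ S) ⊩ P) ((G ⊙ D) ⊙ S ⊩ P)
| sb_comma_assoc_l G D S P :
    structural_bi (S ,, (D ,, G) ⊩ P) ((S ,, D) ,, G ⊩ P)
| sb_comma_assoc_r G D S P :
    structural_bi (P ⊩ S ,, (D ,, G)) (P ⊩ (S ,, D) ,, G).

Inductive structural : sequent -> sequent -> Prop :=
| st_semi_exch_l X Y Z : structural (Y ;; X ⊢ Z) (X ;; Y ⊢ Z)
| st_semi_exch_r X Y Z : structural (Z ⊢ X ;; Y) (Z ⊢ Y ;; X)
| st_semi_weak_l X Y Z : structural (Y ⊢ Z) (X ;; Y ⊢ Z)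
| st_semi_weak_r X Y Z : structural (Z ⊢ Y) (Z ⊢ Y ;; X)
| st_semi_contr_l X Y : structural (X ;; X ⊢ Y) (X ⊢ Y)
| st_semi_contr_r X Y : structural (Y ⊢ X ;; X) (Y ⊢ X)
| st_Phi_weak G D : structural (\Phi ⊩ D) (G ⊩ D)
| st_comma_weak_l G D S : structural (G ⊩ D) (G ,, S ⊩ D)
| st_comma_weak_r G D S : structural (G ⊩ D) (G ⊩ D ,, S)
| st_comma_contr_l G D : structural (G ,, G ⊩ D) (G ⊩ D)
| st_comma_contr_r G D : structural (G ⊩ D ,, D) (G ⊩ D)
| st_comma_exch_l G D S : structural (G ,, D ⊩ S) (D ,, G ⊩ S)
| st_comma_exch_r G D S : structural (S ⊩ G ,, D) (S ⊩ D ,, G)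
| st_gtrdot_comma G D S P :
    structural (P ⊩ (G ⋗ D) ,, (G ⋗ S)) (P ⊩ G ⋗ (D ,, S)).

Inductive D_rule : sequent -> sequent -> Prop :=
| D_bull_semi X Y Z : D_rule (X ⊢ (• Y) ;; (• Z)) (X ⊢ • (Y ;; Z))
| D_bullr_semi G X Y : D_rule (G ⊩ (•r X) ,, (•r Y)) (G ⊩ •r (X ;; Y))
| D_bull_I X : D_rule (X ⊢ \I) (X ⊢ • \I)
| D_bullr_I G : D_rule (G ⊩ \Phi) (G ⊩ •r \I).

Inductive B_rule : sequent -> sequent -> Prop :=
| B_btrir_semi G D Y Z :
    B_rule (G ⊩ (Y ^▶r D) ,, (Z ^▶r D)) (G ⊩ (Y ;; Z) ^▶r D)
| B_btri_semi G Y Z W :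
    B_rule (G ⊩ (Y ^▶ W) ,, (Z ^▶ W)) (G ⊩ (Y ;; Z) ^▶ W)
| B_btriur_semi G D X Y :
    B_rule ((G ^▲r X) ,, (G ^▲r Y) ⊩ D) (G ^▲r (X ;; Y) ⊩ D)
| B_tri_odot G D X Y :
    B_rule (X ⊢ G ^▷ (D ^▷ Y)) (X ⊢ (G ⊙ D) ^▷ Y)
| B_btriur_I G D : B_rule (\Phi ⊩ D) (G ^▲r \I ⊩ D).

Inductive BD_rule : sequent -> sequent -> Prop :=
| BD_tri_bull G X Y : BD_rule (X ⊢ G ^▷ (• Y)) (X ⊢ (∘r G) > Y)
| BD_trir_bullr G X Y : BD_rule (X ⊢ G ^▷r (•r Y)) (X ⊢ G ^▷ Y).

Inductive logical1 : sequent -> sequent -> Prop :=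
| bot_R X : logical1 (X ⊢ \I) (X ⊢ fbot)
| top_L X : logical1 (\I ⊢ X) (ftop ⊢ X)
| and_L A B X : logical1 (A ;; B ⊢ X) (A ∧ B ⊢ X)
| or_R A B X : logical1 (X ⊢ A ;; B) (X ⊢ A ∨ B)
| imp_R A B X : logical1 (X ⊢ A > B) (X ⊢ A ⇒ B)
| zero_R G : logical1 (G ⊩ \Phi) (G ⊩ rzero)
| one_L G : logical1 (\Phi ⊩ G) (rone ⊩ G)
| dot_L α β G : logical1 (α ⊙ β ⊩ G) (α · β ⊩ G)
| join_R α β G : logical1 (G ⊩ α ,, β) (G ⊩ α ⊔ β)
| meet_L α β G : logical1 (α ,, β ⊩ G) (α ⊓ β ⊩ G)
| dia_L A X : logical1 (∘ A ⊢ X) (◇ A ⊢ X)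
| dia_R A X : logical1 (X ⊢ A) (∘ X ⊢ ◇ A)
| tri_R α A X : logical1 (X ⊢ α ^▷ A) (X ⊢ α ▷ A)
| diar_L α X : logical1 (∘r α ⊢ X) (◇r α ⊢ X)
| diar_R α G : logical1 (G ⊩ α) (∘r G ⊢ ◇r α)
| trir_R α β X : logical1 (X ⊢ α ^▷r β) (X ⊢ α ▷r β).

Inductive logical2 : sequent -> sequent -> sequent -> Prop :=
| and_R A B X Y : logical2 (X ⊢ A) (Y ⊢ B) (X ;; Y ⊢ A ∧ B)
| or_L A B X Y : logical2 (A ⊢ X) (B ⊢ Y) (A ∨ B ⊢ X ;; Y)
| imp_L A B X Y : logical2 (X ⊢ A) (B ⊢ Y) (A ⇒ B ⊢ X > Y)
| dot_R α β G D : logical2 (G ⊩ α) (D ⊩ β) (G ⊙ D ⊩ α · β)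
| join_L α β G D : logical2 (α ⊩ G) (β ⊩ D) (α ⊔ β ⊩ G ,, D)
| meet_R α β G D : logical2 (G ⊩ α) (D ⊩ β) (G ,, D ⊩ α ⊓ β)
| tri_L α A G X : logical2 (G ⊩ α) (A ⊢ X) (α ▷ A ⊢ G ^▷ X)
| trir_L α β G D : logical2 (G ⊩ α) (β ⊩ D) (α ▷r β ⊢ G ^▷r D).

Inductive rule1 (S T : sequent) : Prop :=
| rule_display_down of display S T
| rule_display_up of display T S
| rule_structural_down of structural_bi S T
| rule_structural_up of structural_bi T S
| rule_structural of structural S T
| rule_D of D_rule S T
| rule_B of B_rule S T
| rule_BD of BD_rule S T
| rule_logical1 of logical1 S T.

Inductive cut_Fm : sequent -> sequent -> sequent -> Prop :=
| cut_Fm_ant A Z X X' Y :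
    subst_fa A Z X X' -> cut_Fm (X ⊢ Y) (A ⊢ Z) (X' ⊢ Y)
| cut_Fm_suc A Z X Y Y' :
    subst_fs A Z Y Y' -> cut_Fm (X ⊢ Y) (A ⊢ Z) (X ⊢ Y').

Inductive cut_Res : sequent -> sequent -> sequent -> Prop :=
| cut_Res_intro α G D : cut_Res (G ⊩ α) (α ⊩ D) (G ⊩ D).

(* Derivation trees of D.LRC with conclusion the given sequent. *)
Inductive derivation : sequent -> Type :=
| by_axiom T : axiom T -> derivation T
| by_rule1 S T : rule1 S T -> derivation S -> derivation T
| by_rule2 S1 S2 T :
    logical2 S1 S2 T -> derivation S1 -> derivation S2 -> derivation T
| by_cut_Fm S1 S2 T :
    cut_Fm S1 S2 T -> derivation S1 -> derivation S2 -> derivation T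
| by_cut_Res S1 S2 T :
    cut_Res S1 S2 T -> derivation S1 -> derivation S2 -> derivation T.

Definition derivable (S : sequent) : Prop := inhabited (derivation S).

Fixpoint cut_free S (d : derivation S) : Prop :=
  match d with
  | by_axiom _ _ => True
  | by_rule1 _ _ _ d1 => cut_free d1
  | by_rule2 _ _ _ _ d1 d2 => cut_free d1 /\ cut_free d2
  | by_cut_Fm _ _ _ _ _ _ => False
  | by_cut_Res _ _ _ _ _ _ => False
  end.

(* An expression is a formula or a resource term; the subterm relation is
   multi-type, since resource terms occur inside formulas. *)
Inductive expr : Type := EForm of form | ERes of res.

Fixpoint subterm_res (t : expr) α : Prop :=
  t = ERes α \/
  match α with
  | ratom _ | rone | rzero => False
  | rdot α1 α2 | rjoin α1 α2 | rmeet α1 α2 =>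
      subterm_res t α1 \/ subterm_res t α2
  end.

Fixpoint subterm_form (t : expr) A : Prop :=
  t = EForm A \/
  match A with
  | patom _ | ftop | fbot => False
  | for_ A1 A2 | fand A1 A2 | fimp A1 A2 =>
      subterm_form t A1 \/ subterm_form t A2
  | ftri α A1 => subterm_res t α \/ subterm_form t A1
  | fdia A1 => subterm_form t A1
  | fdiar α => subterm_res t α
  | ftrir α β => subterm_res t α \/ subterm_res t β
  end.

Definition subterm (t u : expr) : Prop :=
  match u with
  | EForm A => subterm_form t A
  | ERes α => subterm_res t α
  end.

(* occurs_* t T: the expression t is one of the formulas and resource terms
   from which the structure T is built. *)
Fixpoint occurs_fa (t : expr) (X : fa) : Prop :=
  match X with
  | fa_form A => t = EForm A
  | fa_I => False
  | fa_semi X1 X2 => occurs_fa t X1 \/ occurs_fa t X2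
  | fa_gt X1 X2 => occurs_fs t X1 \/ occurs_fa t X2
  | fa_lt X1 X2 => occurs_fa t X1 \/ occurs_fs t X2
  | fa_circ X1 => occurs_fa t X1
  | fa_circr G => occurs_ra t G
  end
with occurs_fs (t : expr) (X : fs) : Prop :=
  match X with
  | fs_form A => t = EForm A
  | fs_I => False
  | fs_semi X1 X2 => occurs_fs t X1 \/ occurs_fs t X2
  | fs_gt X1 X2 => occurs_fa t X1 \/ occurs_fs t X2
  | fs_lt X1 X2 => occurs_fs t X1 \/ occurs_fa t X2
  | fs_bull X1 => occurs_fs t X1
  | fs_tri G X1 => occurs_ra t G \/ occurs_fs t X1
  | fs_trir G D => occurs_ra t G \/ occurs_rs t D
  end
with occurs_ra (t : expr) (G : ra) : Prop :=
  match G with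
  | ra_res α => t = ERes α
  | ra_Phi => False
  | ra_odot G1 G2 => occurs_ra t G1 \/ occurs_ra t G2
  | ra_comma G1 G2 => occurs_ra t G1 \/ occurs_ra t G2
  | ra_sup G1 G2 => occurs_rs t G1 \/ occurs_ra t G2
  | ra_sub G1 G2 => occurs_ra t G1 \/ occurs_rs t G2
  | ra_btriur G1 X => occurs_ra t G1 \/ occurs_fa t X
  end
with occurs_rs (t : expr) (G : rs) : Prop :=
  match G with
  | rs_res α => t = ERes α
  | rs_Phi => False
  | rs_comma G1 G2 => occurs_rs t G1 \/ occurs_rs t G2
  | rs_gtrdot G1 G2 => occurs_ra t G1 \/ occurs_rs t G2
  | rs_lessdot G1 G2 => occurs_rs t G1 \/ occurs_ra t G2
  | rs_sup G1 G2 => occurs_ra t G1 \/ occurs_rs t G2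
  | rs_sub G1 G2 => occurs_rs t G1 \/ occurs_ra t G2
  | rs_bullr X => occurs_fs t X
  | rs_btri X Y => occurs_fa t X \/ occurs_fs t Y
  | rs_btrir X D => occurs_fa t X \/ occurs_rs t D
  end.

Definition occurs_in_sequent (t : expr) (S : sequent) : Prop :=
  match S with
  | fm_seq X Y => occurs_fa t X \/ occurs_fs t Y
  | res_seq G D => occurs_ra t G \/ occurs_rs t D
  end.

Fixpoint occurs_in_derivation (t : expr) S (d : derivation S) : Prop :=
  occurs_in_sequent t S \/
  match d with
  | by_axiom _ _ => False
  | by_rule1 _ _ _ d1 => occurs_in_derivation t d1
  | by_rule2 _ _ _ _ d1 d2 =>
      occurs_in_derivation t d1 \/ occurs_in_derivation t d2
  | by_cut_Fm _ _ _ _ d1 d2 =>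
      occurs_in_derivation t d1 \/ occurs_in_derivation t d2
  | by_cut_Res _ _ _ _ d1 d2 =>
      occurs_in_derivation t d1 \/ occurs_in_derivation t d2
  end.

End Calculus.

(* Main.v *)
Require Import Defs.
From mathcomp Require Import all_boot.

(** A cut is eliminated in two sweeps.  First the occurrences of the cut formula
    [A] in succedent position are traced upwards and replaced by [Z]; they become
    principal only in sequents [X ⊢ A].  There the occurrences of [A] in
    antecedent position are traced upwards in the derivation of [A ⊢ Z] and
    replaced by [X], until they are principal.  What remains is a principal cut,
    which reduces to cuts on immediate subterms.  Tracing works because every
    rule is closed under a simultaneous replacement in its parameters, and
    because principal terms are displayed.  The only auxiliary
    term that cannot be displayed is the [A] of [α ^▷ A]; it is in succedent
    position and is replaced in place. *)

Set Implicit Arguments.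
Unset Strict Implicit.
Unset Printing Implicit Defensive.

Section CutElimination.

Variables AtProp AtRes : countType.

Local Notation form := (form AtProp AtRes).
Local Notation res := (res AtRes).
Local Notation fa := (fa AtProp AtRes).
Local Notation fs := (fs AtProp AtRes).
Local Notation ra := (ra AtProp AtRes).
Local Notation rs := (rs AtProp AtRes).
Local Notation sequent := (sequent AtProp AtRes).
Local Notation expr := (expr AtProp AtRes).

(** * Replacement of a formula or resource term at one polarity *)

Inductive repl : Type :=
| repl_fa of form & fa
| repl_fs of form & fs
| repl_ra of res & ra
| repl_rs of res & rs.

(** Images of predicates under a constructor. They let replacement be defined by recursion on the
    source structure, so that inverting it is just unfolding. *)
Definition lift1 U T (c : U -> T) (P : U -> Prop) (x : T) : Prop :=
  exists2 u, x = c u & P u.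

Definition lift2 U V T (c : U -> V -> T) (P : U -> Prop) (Q : V -> Prop)
  (x : T) : Prop := exists u v, [/\ x = c u v, P u & Q v].

Lemma lift1I U T (c : U -> T) (P : U -> Prop) u : P u -> lift1 c P (c u).
Proof. by exists u. Qed.

Lemma lift2I U V T (c : U -> V -> T) (P : U -> Prop) (Q : V -> Prop) u v :
  P u -> Q v -> lift2 c P Q (c u v).
Proof. by exists u, v. Qed.

(* Any number of occurrences may be replaced, possibly none: contraction
   duplicates the traced occurrences. *)
Fixpoint cong_fa (r : repl) (X : fa) {struct X} : fa -> Prop :=
  match X with
  | fa_form A => fun X' => X' = fa_form A \/ r = repl_fa A X'
  | fa_I => fun X' => X' = fa_I
  | fa_semi X1 X2 => lift2 (@fa_semi _ _) (cong_fa r X1) (cong_fa r X2)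
  | fa_gt X1 X2 => lift2 (@fa_gt _ _) (cong_fs r X1) (cong_fa r X2)
  | fa_lt X1 X2 => lift2 (@fa_lt _ _) (cong_fa r X1) (cong_fs r X2)
  | fa_circ X1 => lift1 (@fa_circ _ _) (cong_fa r X1)
  | fa_circr G => lift1 (@fa_circr _ _) (cong_ra r G)
  end
with cong_fs (r : repl) (X : fs) {struct X} : fs -> Prop :=
  match X with
  | fs_form A => fun X' => X' = fs_form A \/ r = repl_fs A X'
  | fs_I => fun X' => X' = fs_I
  | fs_semi X1 X2 => lift2 (@fs_semi _ _) (cong_fs r X1) (cong_fs r X2)
  | fs_gt X1 X2 => lift2 (@fs_gt _ _) (cong_fa r X1) (cong_fs r X2)
  | fs_lt X1 X2 => lift2 (@fs_lt _ _) (cong_fs r X1) (cong_fa r X2)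
  | fs_bull X1 => lift1 (@fs_bull _ _) (cong_fs r X1)
  | fs_tri G X1 => lift2 (@fs_tri _ _) (cong_ra r G) (cong_fs r X1)
  | fs_trir G D => lift2 (@fs_trir _ _) (cong_ra r G) (cong_rs r D)
  end
with cong_ra (r : repl) (G : ra) {struct G} : ra -> Prop :=
  match G with
  | ra_res α => fun G' => G' = ra_res α \/ r = repl_ra α G'
  | ra_Phi => fun G' => G' = ra_Phi
  | ra_odot G1 G2 => lift2 (@ra_odot _ _) (cong_ra r G1) (cong_ra r G2)
  | ra_comma G1 G2 => lift2 (@ra_comma _ _) (cong_ra r G1) (cong_ra r G2)
  | ra_sup G1 G2 => lift2 (@ra_sup _ _) (cong_rs r G1) (cong_ra r G2)
  | ra_sub G1 G2 => lift2 (@ra_sub _ _) (cong_ra r G1) (cong_rs r G2)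
  | ra_btriur G1 X => lift2 (@ra_btriur _ _) (cong_ra r G1) (cong_fa r X)
  end
with cong_rs (r : repl) (G : rs) {struct G} : rs -> Prop :=
  match G with
  | rs_res α => fun G' => G' = rs_res α \/ r = repl_rs α G'
  | rs_Phi => fun G' => G' = rs_Phi
  | rs_comma G1 G2 => lift2 (@rs_comma _ _) (cong_rs r G1) (cong_rs r G2)
  | rs_gtrdot G1 G2 => lift2 (@rs_gtrdot _ _) (cong_ra r G1) (cong_rs r G2)
  | rs_lessdot G1 G2 => lift2 (@rs_lessdot _ _) (cong_rs r G1) (cong_ra r G2)
  | rs_sup G1 G2 => lift2 (@rs_sup _ _) (cong_ra r G1) (cong_rs r G2)
  | rs_sub G1 G2 => lift2 (@rs_sub _ _) (cong_rs r G1) (cong_ra r G2)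
  | rs_bullr X => lift1 (@rs_bullr _ _) (cong_fs r X)
  | rs_btri X Y => lift2 (@rs_btri _ _) (cong_fa r X) (cong_fs r Y)
  | rs_btrir X D => lift2 (@rs_btrir _ _) (cong_fa r X) (cong_rs r D)
  end.

Definition cong (r : repl) (S : sequent) : sequent -> Prop :=
  match S with
  | fm_seq X Y => lift2 (@fm_seq _ _) (cong_fa r X) (cong_fs r Y)
  | res_seq G D => lift2 (@res_seq _ _) (cong_ra r G) (cong_rs r D)
  end.

Scheme fa_mutind := Induction for Defs.fa Sort Prop
with fs_mutind := Induction for Defs.fs Sort Prop
with ra_mutind := Induction for Defs.ra Sort Prop
with rs_mutind := Induction for Defs.rs Sort Prop.
Combined Scheme structure_mutind from fa_mutind, fs_mutind, ra_mutind, rs_mutind.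

Lemma cong_structure_refl (r : repl) :
  (forall X : fa, cong_fa r X X) /\ (forall X : fs, cong_fs r X X) /\
  (forall G : ra, cong_ra r G G) /\ (forall G : rs, cong_rs r G G).
Proof.
by apply: structure_mutind => *; rewrite /=; auto using lift1I, lift2I.
Qed.

Scheme subst_fa_mutind := Minimality for Defs.subst_fa Sort Prop
with subst_fs_mutind := Minimality for Defs.subst_fs Sort Prop
with subst_ra_mutind := Minimality for Defs.subst_ra Sort Prop
with subst_rs_mutind := Minimality for Defs.subst_rs Sort Prop.
Combined Scheme subst_mutind
  from subst_fa_mutind, subst_fs_mutind, subst_ra_mutind, subst_rs_mutind.

(** The untouched siblings of the single replaced occurrence are related to themselves. *)
Lemma subst_cong (A : form) (Z : fs) (r := repl_fs A Z) :
  (forall X X' : fa, subst_fa A Z X X' -> cong_fa r X X') /\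
  (forall X X' : fs, subst_fs A Z X X' -> cong_fs r X X') /\
  (forall G G' : ra, subst_ra A Z G G' -> cong_ra r G G') /\
  (forall G G' : rs, subst_rs A Z G G' -> cong_rs r G G').
Proof.
have [Ra [Rs [Pa Ps]]] := cong_structure_refl r.
by apply: subst_mutind => *; rewrite /=; auto using lift1I, lift2I.
Qed.

Ltac cong_inv :=
  repeat match goal with
  | H : lift1 _ _ _ |- _ => case: H => [? ? ?]; subst
  | H : lift2 _ _ _ _ |- _ => case: H => [? [? [? ? ?]]]; subst
  | H : cong_fa _ _ _ |- _ => progress cbn in H
  | H : cong_fs _ _ _ |- _ => progress cbn in H
  | H : cong_ra _ _ _ |- _ => progress cbn in H
  | H : cong_rs _ _ _ |- _ => progress cbn in H
  | H : _ \/ _ |- _ => case: H => ?; subst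
  | H : _ = fa_I |- _ => subst
  | H : _ = fs_I |- _ => subst
  | H : _ = ra_Phi |- _ => subst
  | H : _ = rs_Phi |- _ => subst
  end.

Ltac cong_solve :=
  cbn; repeat first [apply: lift1I | apply: lift2I | assumption
                    | reflexivity | left; reflexivity].

(** * Closure of the non-logical rules under replacement *)

Inductive structural_step (S T : sequent) : Prop :=
| step_display_down of display S T
| step_display_up of display T S
| step_structural_down of structural_bi S T
| step_structural_up of structural_bi T S
| step_structural of structural S T
| step_D of D_rule S T
| step_B of B_rule S T
| step_BD of BD_rule S T.

Lemma structural_step_rule1 (S T : sequent) : structural_step S T -> rule1 S T.
Proof.
by case; [exact: rule_display_down | exact: rule_display_up
         | exact: rule_structural_down | exact: rule_structural_up
         | exact: rule_structural | exact: rule_D | exact: rule_B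
         | exact: rule_BD].
Qed.

Lemma rule1_cases (S T : sequent) :
  rule1 S T -> structural_step S T \/ logical1 S T.
Proof. by case=> *; auto using structural_step. Qed.

(** These rules are schemas in structure variables. Each variable occurs at most once in the
    conclusion, and every premise variable occurs there at the same sort and polarity, so its image
    can be copied into the premise. *)
Lemma structural_step_cong (r : repl) (S T T' : sequent) :
  structural_step S T -> cong r T T' ->
  exists2 S', structural_step S' T' & cong r S S'.
Proof.
case=> h; case: h => *; cbn in *; cong_inv;
  solve [ eexists; [apply: step_display_down; constructor | cong_solve]
        | eexists; [apply: step_display_up; constructor | cong_solve]
        | eexists; [apply: step_structural_down; constructor | cong_solve]
        | eexists; [apply: step_structural_up; constructor | cong_solve]
        | eexists; [apply: step_structural; constructor | cong_solve]
        | eexists; [apply: step_D; constructor | cong_solve]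
        | eexists; [apply: step_B; constructor | cong_solve]
        | eexists; [apply: step_BD; constructor | cong_solve] ].
Qed.

(** * Tracing a term through a cut-free derivation *)

Definition cf (S : sequent) : Prop := exists d : derivation S, cut_free d.

Lemma axiom_cf (T : sequent) : axiom T -> cf T.
Proof. by move=> h; exists (by_axiom h). Qed.

Lemma rule1_cf (S T : sequent) : rule1 S T -> cf S -> cf T.
Proof. by move=> h [d hd]; exists (by_rule1 h d). Qed.

Lemma structural_step_cf (S T : sequent) : structural_step S T -> cf S -> cf T.
Proof. by move/structural_step_rule1/rule1_cf. Qed.

Lemma logical1_cf (S T : sequent) : logical1 S T -> cf S -> cf T.
Proof. by move/rule_logical1/rule1_cf. Qed.

Lemma logical2_cf (S1 S2 T : sequent) :
  logical2 S1 S2 T -> cf S1 -> cf S2 -> cf T.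
Proof. by move=> h [d1 h1] [d2 h2]; exists (by_rule2 h d1 d2). Qed.

(* [suc_intro_Fm A X]: some axiom or right introduction rule yields [X ⊢ A],
   with [A] principal, from cut-free premises; the other three are analogous. *)
Definition suc_intro_Fm (A : form) : fa -> Prop :=
  match A with
  | patom p => fun X => X = fa_form (patom p)
  | ftop => fun X => X = fa_I
  | fbot => fun X => cf (X ⊢ \I)
  | for_ A B => fun X => cf (X ⊢ A ;; B)
  | fand A B =>
      lift2 (@fa_semi _ _) (fun X => cf (X ⊢ A)) (fun X => cf (X ⊢ B))
  | fimp A B => fun X => cf (X ⊢ A > B)
  | ftri α A => fun X => cf (X ⊢ α ^▷ A)
  | fdia A => lift1 (@fa_circ _ _) (fun X => cf (X ⊢ A))
  | fdiar α => lift1 (@fa_circr _ _) (fun G => cf (G ⊩ α))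
  | ftrir α β => fun X => cf (X ⊢ α ^▷r β)
  end.

Definition ant_intro_Fm (A : form) : fs -> Prop :=
  match A with
  | patom p => fun Z => Z = fs_form (patom p)
  | ftop => fun Z => cf (\I ⊢ Z)
  | fbot => fun Z => Z = fs_I
  | for_ A B =>
      lift2 (@fs_semi _ _) (fun Z => cf (A ⊢ Z)) (fun Z => cf (B ⊢ Z))
  | fand A B => fun Z => cf (A ;; B ⊢ Z)
  | fimp A B =>
      lift2 (@fs_gt _ _) (fun X => cf (X ⊢ A)) (fun Z => cf (B ⊢ Z))
  | ftri α A =>
      lift2 (@fs_tri _ _) (fun G => cf (G ⊩ α)) (fun Z => cf (A ⊢ Z))
  | fdia A => fun Z => cf (∘ A ⊢ Z)
  | fdiar α => fun Z => cf (∘r α ⊢ Z)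
  | ftrir α β =>
      lift2 (@fs_trir _ _) (fun G => cf (G ⊩ α)) (fun D => cf (β ⊩ D))
  end.

Definition suc_intro_Res (α : res) : ra -> Prop :=
  match α with
  | ratom a => fun G => G = ra_res (ratom a)
  | rone => fun G => G = ra_Phi
  | rzero => fun G => cf (G ⊩ \Phi)
  | rdot α β =>
      lift2 (@ra_odot _ _) (fun G => cf (G ⊩ α)) (fun G => cf (G ⊩ β))
  | rjoin α β => fun G => cf (G ⊩ α ,, β)
  | rmeet α β =>
      lift2 (@ra_comma _ _) (fun G => cf (G ⊩ α)) (fun G => cf (G ⊩ β))
  end.

Definition ant_intro_Res (α : res) : rs -> Prop :=
  match α with
  | ratom a => fun D => D = rs_res (ratom a)
  | rone => fun D => cf (\Phi ⊩ D)
  | rzero => fun D => D = rs_Phi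
  | rdot α β => fun D => cf (α ⊙ β ⊩ D)
  | rjoin α β =>
      lift2 (@rs_comma _ _) (fun D => cf (α ⊩ D)) (fun D => cf (β ⊩ D))
  | rmeet α β => fun D => cf (α ,, β ⊩ D)
  end.

(** What tracing requires where the traced term is principal: its replacement must be derivable
    against the other side of that introduction. *)
Definition head_admissible (r : repl) : Prop :=
  match r with
  | repl_fa A X => forall Z, ant_intro_Fm A Z -> cf (X ⊢ Z)
  | repl_fs A Z => forall X, suc_intro_Fm A X -> cf (X ⊢ Z)
  | repl_ra α G => forall D, ant_intro_Res α D -> cf (G ⊩ D)
  | repl_rs α D => forall G, suc_intro_Res α G -> cf (G ⊩ D)
  end.

Ltac premise :=
  match goal with
  | IH : forall S', _ -> cf S' |- _ => solve [apply: IH; cong_solve]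
  end.

Ltac head_intro :=
  match goal with hr : head_admissible _ |- _ => apply: hr; cbn end;
  solve [ reflexivity | premise | apply: lift1I; premise
        | apply: lift2I; premise ].

Lemma axiom_cong (r : repl) (T T' : sequent) :
  head_admissible r -> axiom T -> cong r T T' -> cf T'.
Proof.
(* [congruence] discards the replacement of an atom on both sides, since [r] acts at one polarity
   only. *)
move=> hr; case=> *; cbn in *; cong_inv; try congruence;
  solve [ apply: axiom_cf; constructor | head_intro ].
Qed.

(** If the principal term is kept, the rule is reapplied to the rewritten premise, with auxiliary
    terms left unreplaced. If it is replaced, [head_admissible] applies to the already rewritten
    context. *)
Lemma logical1_cong (r : repl) (S T T' : sequent) :
  head_admissible r -> logical1 S T -> (forall S', cong r S S' -> cf S') ->
  cong r T T' -> cf T'.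
Proof.
move=> hr; case=> *; cbn in *; cong_inv;
  solve [ apply: logical1_cf; [constructor | premise] | head_intro ].
Qed.

Lemma logical2_cong (r : repl) (S1 S2 T T' : sequent) :
  head_admissible r -> logical2 S1 S2 T ->
  (forall S', cong r S1 S' -> cf S') -> (forall S', cong r S2 S' -> cf S') ->
  cong r T T' -> cf T'.
Proof.
move=> hr; case=> *; cbn in *; cong_inv;
  solve [ apply: logical2_cf; [constructor | premise ..] | head_intro ].
Qed.

Lemma cong_cf (r : repl) (T T' : sequent) :
  head_admissible r -> cf T -> cong r T T' -> cf T'.
Proof.
move=> hr [d]; elim: d T' => {T}
  [T h | S T h d IH | S1 S2 T h d1 IH1 d2 IH2 | // | //] T' hd hT.
- exact: axiom_cong hr h hT.
- have IH' S' : cong r S S' -> cf S' by apply: IH.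
  case: (rule1_cases h) => h'; last exact: logical1_cong hr h' IH' hT.
  have [S' hS' /IH'] := structural_step_cong h' hT.
  exact: structural_step_cf.
- case: hd => hd1 hd2.
  by apply: (logical2_cong hr h _ _ hT) => S'; [apply: IH1 | apply: IH2].
Qed.

(** * Reduction of principal cuts and admissibility of cut *)

Definition principal_Fm (A : form) : Prop :=
  forall X Z, suc_intro_Fm A X -> ant_intro_Fm A Z -> cf (X ⊢ Z).

Definition principal_Res (α : res) : Prop :=
  forall G D, suc_intro_Res α G -> ant_intro_Res α D -> cf (G ⊩ D).

(** The cut formula need not be displayed, so that as an induction hypothesis this applies inside
    [α ^▷ A]. *)
Definition cut_admissible_Fm (A : form) : Prop :=
  forall Z T T', cong (repl_fs A Z) T T' -> cf T -> cf (A ⊢ Z) -> cf T'.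

Definition cut_admissible_Res (α : res) : Prop :=
  forall G D, cf (G ⊩ α) -> cf (α ⊩ D) -> cf (G ⊩ D).

Lemma principal_cut_Fm (A : form) : principal_Fm A -> cut_admissible_Fm A.
Proof.
move=> hA Z T T' hT cT cZ; apply: cong_cf cT hT => X iX.
have hr : head_admissible (repl_fa A X) by move=> Y; apply: hA.
(* Only the displayed [A] is replaced; [Z] stays fixed even if [A] occurs in it in antecedent
   position. *)
apply: cong_cf hr cZ _; apply: lift2I; first by right.
by have [_ []] := cong_structure_refl (repl_fa A X).
Qed.

Lemma principal_cut_Res (α : res) : principal_Res α -> cut_admissible_Res α.
Proof.
move=> hα G D cG cD.
have hs : head_admissible (repl_rs α D).
  move=> S iS; have hr : head_admissible (repl_ra α S) by move=> P; apply: hα.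
  apply: cong_cf hr cD _; apply: lift2I; first by right.
  by have [_ [_ []]] := cong_structure_refl (repl_ra α S).
apply: cong_cf hs cG _; apply: lift2I; last by right.
by have [_ [_ []]] := cong_structure_refl (repl_rs α D).
Qed.

Lemma cut_admissible_Fm_displayed (A : form) (X : fa) (Z : fs) :
  cut_admissible_Fm A -> cf (X ⊢ A) -> cf (A ⊢ Z) -> cf (X ⊢ Z).
Proof.
move=> hA; apply: hA; apply: lift2I; last by right.
by have [] := cong_structure_refl (repl_fs A Z).
Qed.

Lemma display_cf (S T : sequent) : display S T -> cf S <-> cf T.
Proof.
by move=> h; split; apply: rule1_cf; [apply: rule_display_down
                                     | apply: rule_display_up].
Qed.

(** Induction on the term suffices, since the sweeps absorb the derivations. For a binary connective
    the two components are displayed and cut one after the other. *)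
Lemma cut_Res_admissible (α : res) : cut_admissible_Res α.
Proof.
elim: α => [a | | | α hα β hβ | α hα β hβ | α hα β hβ];
  apply: principal_cut_Res => G D /=.
- by move=> -> ->; apply: axiom_cf; constructor.
- by move=> ->.
- by move=> cG ->.
- move=> [G1 [G2 [-> c1 c2]]] /(display_cf (disp_odot_gtrdot _ _ _)) /(hβ _ _ c2).
  move/(display_cf (disp_odot_gtrdot _ _ _))/(display_cf (disp_odot_lessdot _ _ _)).
  by move/(hα _ _ c1)/(display_cf (disp_odot_lessdot _ _ _)).
- move=> cG [D1 [D2 [-> c1 c2]]].
  move/(display_cf (disp_sup_comma _ _ _)): cG => /hβ/(_ c2).
  move/(display_cf (disp_sup_comma _ _ _))/(display_cf (disp_sub_comma _ _ _)).
  by move/hα/(_ c1)/(display_cf (disp_sub_comma _ _ _)).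
- move=> [G1 [G2 [-> c1 c2]]] /(display_cf (disp_comma_sup _ _ _)) /(hβ _ _ c2).
  move/(display_cf (disp_comma_sup _ _ _))/(display_cf (disp_comma_sub _ _ _)).
  by move/(hα _ _ c1)/(display_cf (disp_comma_sub _ _ _)).
Qed.

(** Cuts on resource terms are settled beforehand: formulas contain resource terms, but not
    conversely. *)
Lemma cut_Fm_admissible (A : form) : cut_admissible_Fm A.
Proof.
have hR := cut_Res_admissible.
elim: A => [p | | | A hA B hB | A hA B hB | A hA B hB | α A hA | A hA | α | α β];
  apply: principal_cut_Fm => X Z /=;
  (try have {}dA := cut_admissible_Fm_displayed hA);
  (try have {}dB := cut_admissible_Fm_displayed hB).
- by move=> -> ->; apply: axiom_cf; constructor.
- by move=> ->.
- by move=> cX ->.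
- move=> cX [Z1 [Z2 [-> c1 c2]]].
  move/(display_cf (disp_gt_semi _ _ _)): cX => /dB/(_ c2).
  move/(display_cf (disp_gt_semi _ _ _))/(display_cf (disp_lt_semi _ _ _)).
  by move/dA/(_ c1)/(display_cf (disp_lt_semi _ _ _)).
- move=> [X1 [X2 [-> c1 c2]]] /(display_cf (disp_semi_gt _ _ _)) /(dB _ _ c2).
  move/(display_cf (disp_semi_gt _ _ _))/(display_cf (disp_semi_lt _ _ _)).
  by move/(dA _ _ c1)/(display_cf (disp_semi_lt _ _ _)).
(* Read backwards: [B] is replaced by [W] inside [A > B], then [A] is displayed and cut with
   [Y ⊢ A]. *)
- move=> cX [Y [W [-> cY cW]]]; apply/(display_cf (disp_semi_gt _ _ _)).
  apply/(display_cf (disp_semi_lt _ _ _)); apply: dA cY _.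
  apply/(display_cf (disp_semi_lt _ _ _))/(display_cf (disp_semi_gt _ _ _)).
  apply: hB cX cW; apply: lift2I.
    by have [] := cong_structure_refl (repl_fs B W).
  by apply: lift2I; [left | right].
- move=> cX [G [W [-> cG cW]]]; apply/(display_cf (disp_tri _ _ _)).
  apply: (hR α) cG _; apply/(display_cf (disp_tri _ _ _)).
  apply: hA cX cW; apply: lift2I.
    by have [] := cong_structure_refl (repl_fs A W).
  by apply: lift2I; [left | right].
- move=> [Y -> cY] /(display_cf (disp_circ _ _)) cZ.
  by apply/(display_cf (disp_circ _ _)); apply: dA cY cZ.
- move=> [G -> cG] /(display_cf (disp_circr _ _)) cZ.
  by apply/(display_cf (disp_circr _ _)); apply: hR cG cZ.
(* Unlike for [^▷], both components can be displayed: [β] through [^▲r], then [α] through [^▶r]. *)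
- move=> cX [G [D [-> cG cD]]]; apply/(display_cf (disp_trir _ _ _)).
  apply: (hR α) cG _.
  apply/(display_cf (disp_trir _ _ _))/(display_cf (disp_trir_up _ _ _)).
  by apply: (hR β) cD; apply/(display_cf (disp_trir_up _ _ _)).
Qed.

Theorem cut_elimination (S : sequent) (d : derivation S) : cf S.
Proof.
elim: d => {S} [T h | S T h _ | S1 S2 T h _ c1 _ c2
               | S1 S2 T h _ c1 _ c2 | S1 S2 T h _ c1 _ c2].
- exact: axiom_cf.
- exact: rule1_cf h.
- exact: logical2_cf h c1 c2.
(* The replaced occurrence lies in the antecedent or in the succedent; the other side is related to
   itself. *)
- case: h c1 c2 => A Z X.
    move=> X' Y hX; apply: cut_Fm_admissible; apply: lift2I.
      by have [+ _] := subst_cong A Z; apply.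
    by have [_ []] := cong_structure_refl (repl_fs A Z).
  move=> Y Y' hY; apply: cut_Fm_admissible; apply: lift2I.
    by have [] := cong_structure_refl (repl_fs A Z).
  by have [_ [+ _]] := subst_cong A Z; apply.
- by case: h c1 c2 => α G D; apply: cut_Res_admissible.
Qed.

(** * The subformula property *)

Lemma subterm_trans (s t u : expr) : subterm s t -> subterm t u -> subterm s u.
Proof.
move=> hst; have hR α : subterm_res t α -> subterm_res s α.
  by elim: α => /= *; intuition (subst; auto).
case: u => [A | α] /=; last exact: hR.
by elim: A => /= *; intuition (subst; auto).
Qed.

Lemma subterm_form_refl (A : form) : subterm_form (EForm A) A.
Proof. by case: A; left. Qed.

Lemma subterm_res_refl (α : res) : subterm_res (ERes AtProp α) α.
Proof. by case: α; left. Qed.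

Lemma subterm_refl (t : expr) : subterm t t.
Proof. by case: t => ?; [apply: subterm_form_refl | apply: subterm_res_refl]. Qed.

Definition covered (T : sequent) (t : expr) : Prop :=
  exists u, occurs_in_sequent u T /\ subterm t u.

Lemma covered_occurs (T : sequent) (t : expr) :
  occurs_in_sequent t T -> covered T t.
Proof. by exists t; split=> //; apply: subterm_refl. Qed.

Lemma covered_trans (S T : sequent) (t : expr) :
  (forall u, occurs_in_sequent u S -> covered T u) -> covered S t -> covered T t.
Proof.
move=> h [u [/h [v [hv huv]] htu]].
by exists v; split=> //; apply: subterm_trans huv.
Qed.

(** Downwards these rules lose no term: contraction merges equal copies, and all other material
    persists. *)
Lemma structural_step_covered (S T : sequent) (t : expr) :
  structural_step S T -> occurs_in_sequent t S -> covered T t.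
Proof.
by move=> h hS; apply: covered_occurs; case: h hS => -[] * /=; cbn in *; tauto.
Qed.

Ltac immediate_subterm :=
  repeat match goal with H : _ \/ _ |- _ => case: H => ? end; subst;
  first [ solve [apply: covered_occurs; cbn; tauto]
        | solve [eexists; split;
            [cbn; eauto | cbn; auto 6 using subterm_form_refl, subterm_res_refl]] ].

(** Context terms persist, and auxiliary terms are immediate subterms of the principal one. *)
Lemma logical1_covered (S T : sequent) (t : expr) :
  logical1 S T -> occurs_in_sequent t S -> covered T t.
Proof. by case=> * /=; cbn in *; immediate_subterm. Qed.

Lemma logical2_covered (S1 S2 T : sequent) (t : expr) :
  logical2 S1 S2 T -> occurs_in_sequent t S1 \/ occurs_in_sequent t S2 ->
  covered T t.
Proof. by case=> * /=; cbn in *; immediate_subterm. Qed.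

(** Only a cut can make a term vanish on the way down; for the other rules, covering propagates by
    transitivity of [subterm]. *)
Lemma cut_free_covered (S : sequent) (d : derivation S) (t : expr) :
  cut_free d -> occurs_in_derivation t d -> covered S t.
Proof.
elim: d => {S} [T h | S T h d IH | S1 S2 T h d1 IH1 d2 IH2 | // | //] /=.
- by move=> _ [/covered_occurs|].
- move=> hd [/covered_occurs // | /(IH hd)]; apply: covered_trans => u.
  by case: (rule1_cases h); [apply: structural_step_covered
                            | apply: logical1_covered].
- move=> [hd1 hd2] [/covered_occurs // | [/(IH1 hd1) | /(IH2 hd2)]];
    apply: covered_trans => u hu; apply: (logical2_covered h);
    by [left | right].
Qed.

End CutElimination.

Theorem mainTheorem6 (AtProp AtRes : countType) :
  (forall S : sequent AtProp AtRes, derivable S ->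
     exists d : derivation S, cut_free d) /\
  (forall S : sequent AtProp AtRes, derivable S ->
     exists d : derivation S,
       forall t : expr AtProp AtRes, occurs_in_derivation t d ->
         exists u : expr AtProp AtRes, occurs_in_sequent u S /\ subterm t u).
Proof.
split=> S [d]; first exact: cut_elimination d.
have [d' hd'] := cut_elimination d.
by exists d' => t; apply: cut_free_covered.
Qed.
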